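(* Let $\Psi:\mathrm{Conv}(\mathbb{R}^n,\mathbb{R})\rightarrow\mathcal{M}(\mathbb{R}^n)$ be a continuous local functional. Then $\Psi$ is a valuation, i.e. $$\Psi(f)+\Psi(h)=\Psi(f\vee h)+\Psi(f\wedge h)$$ for all $f,h\in\mathrm{Conv}(\mathbb{R}^n,\mathbb{R})$ such that the pointwise minimum $f\wedge h$ belongs to $\mathrm{Conv}(\mathbb{R}^n,\mathbb{R})$, where $f\vee h$ denotes the pointwise maximum.
   Context: $\mathrm{Conv}(\mathbb{R}^n,\mathbb{R})$ is the space of all finite convex functions $f:\mathbb{R}^n\to\mathbb{R}$, equipped with the (metrizable) topology of locally uniform convergence. $\mathcal{M}(\mathbb{R}^n)$ is the space of complex Radon measures on $\mathbb{R}^n$, identified with the topological dual $C_c(\mathbb{R}^n)'$ of the space of compactly supported continuous (complex-valued) functions with its usual inductive limit topology, and equipped with the weak* topology. A map $\Psi:\mathrm{Conv}(\mathbb{R}^n,\mathbb{R})\to\mathcal{M}(\mathbb{R}^n)$ is called a local functional (or locally determined) if for all $f,h\in\mathrm{Conv}(\mathbb{R}^n,\mathbb{R})$ and every open $U\subset\mathbb{R}^n$ with $f|_U=h|_U$ one has $\Psi(f)|_U=\Psi(h)|_U$ (equality of the restricted measures). *)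

(* Defs.v *)
From HB Require Import structures.
From mathcomp Require Import all_boot all_order all_algebra.
From mathcomp Require Import all_classical all_reals all_analysis.
From mathcomp Require Import complex.

Set Implicit Arguments.
Unset Strict Implicit.
Unset Printing Implicit Defensive.

Import Order.TTheory GRing.Theory Num.Theory.
Import numFieldNormedType.Exports.

Local Open Scope classical_set_scope.
Local Open Scope ring_scope.
Local Open Scope complex_scope.

Lemma continuous_lincomb (T : topologicalType) (K : numFieldType) (a : K)
    (f g : T -> K^o) :
  continuous f -> continuous g -> continuous (fun x => a *: f x + g x : K^o).
Proof.
move=> cf cg x; apply: (@cvgD _ K^o); last exact: cg.
by apply: (@cvgZl_tmp _ K^o); exact: cf.
Qed.

Section Conv.
Variables (R : realType) (n : nat).

Definition is_conv : {pred 'rV[R]_n -> R} :=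
  [pred f | `[< convex_function [set: 'rV[R]_n] f >]].

Record Conv := MkConv { conv_fun :> 'rV[R]_n -> R ; _ : conv_fun \in is_conv }.

HB.instance Definition _ := [isSub for conv_fun].
HB.instance Definition _ := [Choice of Conv by <:].

(* R^n being locally compact, locally uniform convergence is uniform
   convergence on compact sets. *)
HB.instance Definition _ := Topological.copy Conv
  (initial_topology (conv_fun : Conv -> {family compact, 'rV[R]_n -> R})).

Lemma max_is_conv (f h : Conv) : (f : 'rV[R]_n -> R) \max h \in is_conv.
Proof.
case: f h => f fP [h hP]; have cf := asboolW fP; have ch := asboolW hP.
apply/asboolP => t x y xT yT.
have t0 : 0 <= t%:num by []; have t1 : 0 <= 1 - t%:num by rewrite subr_ge0.
have := cf t x y xT yT; have := ch t x y xT yT; rewrite !convRE => hle fle.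
have lef z : f z <= Num.max (f z) (h z) by rewrite le_max lexx.
have leh z : h z <= Num.max (f z) (h z) by rewrite le_max lexx orbT.
rewrite ge_max; apply/andP; split.
- apply: le_trans fle _; apply: lerD; first exact: ler_wpM2l t0 _ _ (lef x).
  exact: ler_wpM2l t1 _ _ (lef y).
- apply: le_trans hle _; apply: lerD; first exact: ler_wpM2l t0 _ _ (leh x).
  exact: ler_wpM2l t1 _ _ (leh y).
Qed.

Definition conv_max (f h : Conv) : Conv := MkConv (max_is_conv f h).

End Conv.

Section TestFunctions.
Variables (R : realType) (n : nat).

Definition tsupp (phi : 'rV[R]_n -> R[i]^o) : set 'rV[R]_n :=
  closure [set x | phi x != 0].

Definition is_test : {pred 'rV[R]_n -> R[i]^o} :=
  [pred phi | `[< continuous phi /\ compact (tsupp phi) >]].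

Lemma is_test_submod_closed : submod_closed is_test.
Proof.
split.
  apply/asboolP; split; first exact: cst_continuous.
  rewrite /tsupp (_ : [set _ | _] = set0) ?closure0; first exact: compact0.
  by apply/seteqP; split => x //=; rewrite eqxx.
move=> a f g /asboolP[cf kf] /asboolP[cg kg]; apply/asboolP; split.
  exact: (@continuous_lincomb _ R[i] a f g cf cg).
apply: (subclosed_compact _ (compactU kf kg)); first exact: closed_closure.
rewrite /tsupp -closureU; apply: closure_subset => x /= fgx.
have [fx0|] := eqVneq (f x) 0; last by left.
right; apply: contraNneq fgx => gx0.
by rewrite fctE /= fctE fx0 gx0 scaler0 addr0.
Qed.

HB.instance Definition _ :=
  GRing.isSubmodClosed.Build _ _ is_test is_test_submod_closed.

Record Cc := MkCc { test_fun :> 'rV[R]_n -> R[i]^o ; _ : test_fun \in is_test }.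

HB.instance Definition _ := [isSub for test_fun].
HB.instance Definition _ := [Choice of Cc by <:].
HB.instance Definition _ := [SubChoice_isSubLmodule of Cc by <:].

Definition balanced (V : set Cc) :=
  forall (a : R[i]) (phi : Cc), `|a| <= 1 -> V phi -> V (a *: phi).

(* For K compact, C_K is the space of test functions supported in K, with the
   sup norm; the trace of V on each C_K is a neighborhood of 0. *)
Definition nbhs0_on_compacts (V : set Cc) :=
  forall K : set 'rV[R]_n, compact K ->
    exists2 e : R, 0 < e & forall phi : Cc, tsupp phi `<=` K ->
      (forall x, `|phi x| <= e%:C) -> V phi.

(* Inductive limit topology: the finest locally convex topology for which the
   inclusions of the C_K are continuous. The absolutely convex sets whose traces
   on all C_K are neighborhoods of 0 form a base of neighborhoods of 0. *)
Definition Cc_open (W : set Cc) := forall phi, W phi ->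
  exists V : set Cc, [/\ convex_set V, balanced V, nbhs0_on_compacts V &
    forall psi, V psi -> W (phi + psi)].

Lemma Cc_openT : Cc_open setT.
Proof.
move=> phi _; exists setT; by split => //; move=> K _; exists 1.
Qed.

Lemma Cc_openI : setI_closed Cc_open.
Proof.
move=> A B oA oB phi [/oA[V [cV bV nV VA]] /oB[W [cW bW nW WB]]].
exists (V `&` W); split.
- move=> x y l /set_mem[Vx Wx] /set_mem[Vy Wy]; apply/mem_set; split.
  + by apply/set_mem; apply: cV; exact: mem_set.
  + by apply/set_mem; apply: cW; exact: mem_set.
- by move=> a psi a1 [Vpsi Wpsi]; split; [exact: bV|exact: bW].
- move=> K cK; have [e e0 eV] := nV K cK; have [d d0 dW] := nW K cK.
  exists (Num.min e d) => [|psi psiK psile]; first by rewrite lt_min e0.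
  split; [apply: eV => // x|apply: dW => // x]; apply: le_trans (psile x) _;
    by rewrite lecR ge_min lexx ?orbT.
- by move=> psi [/VA Apsi /WB Bpsi].
Qed.

Lemma Cc_open_bigU (I : Type) (F : I -> set Cc) :
  (forall i, Cc_open (F i)) -> Cc_open (\bigcup_i F i).
Proof.
move=> oF phi [i _ /(oF i)[V [cV bV nV VF]]].
by exists V; split => // psi /VF Fpsi; exists i.
Qed.

HB.instance Definition _ :=
  isOpenTopological.Build Cc Cc_openT Cc_openI Cc_open_bigU.

End TestFunctions.

Section Measures.
Variables (R : realType) (n : nat).

Definition is_meas : {pred Cc R n -> R[i]^o} :=
  [pred mu | `[< linear (mu : Cc R n -> R[i]^o) /\ continuous mu >]].

Lemma is_meas_submod_closed : submod_closed is_meas.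
Proof.
split.
  apply/asboolP; split; last exact: cst_continuous.
  by move=> a x y; rewrite -[LHS]/(0 : R[i]^o) -[RHS]/(a *: 0 + 0 : R[i]^o)
    scaler0 addr0.
move=> a f g /asboolP[lf cf] /asboolP[lg cg]; apply/asboolP; split.
  move=> b x y; rewrite -[LHS]/(a *: f (b *: x + y) + g (b *: x + y) : R[i]^o).
  rewrite -[RHS]/(b *: (a *: f x + g x) + (a *: f y + g y) : R[i]^o) lf lg.
  by rewrite !scalerDr addrACA !scalerA [a * b]mulrC.
exact: (@continuous_lincomb _ R[i] a f g cf cg).
Qed.

HB.instance Definition _ :=
  GRing.isSubmodClosed.Build _ _ is_meas is_meas_submod_closed.

(* Complex Radon measures are identified with the topological dual of Cc. *)
Record Meas := MkMeas { meas_fun :> Cc R n -> R[i]^o ; _ : meas_fun \in is_meas }.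

HB.instance Definition _ := [isSub for meas_fun].
HB.instance Definition _ := [Choice of Meas by <:].
HB.instance Definition _ := [SubChoice_isSubLmodule of Meas by <:].

(* The topology of pointwise convergence on Cc is the weak* topology. *)
HB.instance Definition _ := Topological.copy Meas
  (initial_topology (meas_fun : Meas -> {ptws Cc R n -> R[i]^o})).

(* mu and nu have the same restriction to the open set U, a measure on U being
   a functional on the test functions whose support is contained in U. *)
Definition eq_meas_on (U : set 'rV[R]_n) (mu nu : Meas) :=
  forall phi : Cc R n, tsupp phi `<=` U -> mu phi = nu phi.

Definition local_functional (Psi : Conv R n -> Meas) :=
  forall (f h : Conv R n) (U : set 'rV[R]_n), open U ->
    (forall x, U x -> f x = h x) -> eq_meas_on U (Psi f) (Psi h).

Definition valuation (Psi : Conv R n -> Meas) :=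
  forall f h m : Conv R n, (forall x, m x = Num.min (f x) (h x)) ->
    Psi f + Psi h = Psi (conv_max f h) + Psi m.

End Measures.

(* Main.v *)
(* For [e > 0] put [f_e = m \max (f - e)] and [h_e = m \max (h - e)], where
   [m = f \min h]. These are convex, [f_e \min h_e = m] and
   [f_e \max h_e = m \max (f \max h - e)]. On the open set [f - h < e] one has
   [f_e = m], on the open set [h - f < e] one has [h_e = m], and these two sets
   cover R^n, so locality and a partition of unity give the valuation identity
   for [f_e] and [h_e]. Let [e] tend to 0 and use the continuity of [Psi]. *)
Require Import Defs.
From mathcomp Require Import all_boot all_order all_algebra.
From mathcomp Require Import all_classical all_reals all_analysis.
From mathcomp Require Import complex ring lra.

Set Implicit Arguments.
Unset Strict Implicit.
Unset Printing Implicit Defensive.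

Import Order.TTheory GRing.Theory Num.Theory.
Import numFieldNormedType.Exports.

Local Open Scope classical_set_scope.
Local Open Scope ring_scope.
Local Open Scope complex_scope.

Section ConvexContinuity.
Variables (R : realType) (n : nat).
Implicit Types f : Conv R n.

Lemma conv_fun_le f (t : R) x y : 0 <= t <= 1 ->
  f (t *: x + (1 - t) *: y) <= t * f x + (1 - t) * f y.
Proof.
case: f => f /[dup] fP /asboolW cf /= /andP[t0 t1].
have := cf (Itv01 t0 t1) x y (in_setT _) (in_setT _).
by rewrite convRE.
Qed.

Lemma conv_sub_in_conv f (e : R) : (fun x => f x - e) \in @is_conv R n.
Proof.
apply/asboolP => t x y _ _.
have t01 : 0 <= (t%:num : R) <= 1 by apply/andP; split.
rewrite convRE /unstable.onem.
apply: le_trans (lerB (conv_fun_le f x y t01) (lexx e)) _; lra.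
Qed.

Definition conv_sub f (e : R) : Conv R n := MkConv (conv_sub_in_conv f e).

Lemma conv_mean_le f (x : 'rV[R]_n) (s : seq 'rV[R]_n) :
  (size s)%:R * (f (x + (size s)%:R^-1 *: \sum_(v <- s) v) - f x)
  <= \sum_(v <- s) (f (x + v) - f x).
Proof.
elim: s => [|v s IHs]; first by rewrite !big_nil mul0r.
rewrite !big_cons /=; set k : R := (size s)%:R in IHs *.
have k0 : 0 <= k by [].
have kE : (size s).+1%:R = k + 1 :> R by rewrite -addn1 natrD.
rewrite {}kE; have k1 : k + 1 != 0 by apply: lt0r_neq0; lra.
set t : R := (k + 1)^-1.
have tk : t * (k + 1) = 1 by rewrite mulVf.
have t0 : 0 <= t by rewrite invr_ge0; lra.
have t01 : 0 <= t <= 1 by apply/andP; split => //; nra.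
have := conv_fun_le f (x + v) (x + k^-1 *: \sum_(w <- s) w) t01.
have -> : t *: (x + v) + (1 - t) *: (x + k^-1 *: \sum_(w <- s) w)
        = x + t *: (v + \sum_(w <- s) w).
  rewrite !scalerDr !scalerA addrACA -scalerDl [t + _]addrC subrK scale1r.
  congr (_ + (_ + _)).
  have [s0|s0] := eqVneq (size s) 0; first by rewrite (size0nil s0) big_nil !scaler0.
  congr (_ *: _); have kn0 : k != 0 by rewrite pnatr_eq0.
  have -> : 1 - t = t * k.
    by lra.
  by rewrite mulfK.
set a := f (x + v); set b := f (x + k^-1 *: _) in IHs *.
set c := f (x + t *: _); set S := \sum_(j <- s) _ in IHs *; move=> h.
have h' : (k + 1) * c <= a + k * b.
  have -> : a + k * b = (k + 1) * (t * a + (1 - t) * b).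
    have -> : (k + 1) * (t * a + (1 - t) * b)
      = t * (k + 1) * (a - b) + (k + 1) * b by ring.
    by rewrite tk; ring.
  by apply: ler_wpM2l => //; lra.
nra.
Qed.

Lemma conv_ray_le f x (v : 'rV[R]_n) (s : R) : `|s| <= 1 ->
  f (x + s *: v) - f x <= `|s| * (`|f (x + v) - f x| + `|f (x - v) - f x|).
Proof.
wlog s0 : v s / 0 <= s => [wl|].
  have [s0|s0] := leP 0 s; first exact: wl.
  move=> s1; rewrite -[s *: v]opprK -scaleNr -scalerN -normrN [X in _ * X]addrC.
  have := wl (- v) (- s); rewrite opprK; apply; last by rewrite normrN.
  by rewrite oppr_ge0 ltW.
rewrite ger0_norm // => s1.
have s01 : 0 <= s <= 1 by rewrite s0.
have := conv_fun_le f (x + v) x s01.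
have -> : s *: (x + v) + (1 - s) *: x = x + s *: v.
  by rewrite scalerDr addrAC -scalerDl [s + _]addrC subrK scale1r.
set a := f (x + v); set b := f x => h.
have h1 : s * (a - b) <= s * `|a - b| by apply: ler_wpM2l => //; exact: ler_norm.
have h2 : 0 <= s * `|f (x - v) - b| by exact: mulr_ge0.
rewrite mulrDr; lra.
Qed.

(* With [N = n], [w] is the mean of the [n] axis vectors [N w_j e_j], on which
   the increment of [f] is controlled by convexity along the axis. *)
Lemma conv_upper_lipschitz f x : exists2 C : R, 0 <= C &
  forall w, n%:R * `|w| <= 1 -> f (x + w) - f x <= C * `|w|.
Proof.
pose e j : 'rV[R]_n := delta_mx 0 j.
pose c j := `|f (x + e j) - f x| + `|f (x - e j) - f x|.
have c0 j : 0 <= c j by exact: addr_ge0.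
exists (\sum_j c j) => [|w w1]; first by apply: sumr_ge0 => j _.
have [n0|n0] := eqVneq n 0%N.
  have -> : w = 0 by apply/rowP => j; have := ltn_ord j; rewrite [X in (_ < X)%N]n0.
  by rewrite addr0 subrr normr0 mulr0.
pose N : R := n%:R; have N0 : 0 < N by rewrite ltr0n lt0n.
pose s := [seq (N * w 0 j) *: e j | j <- enum 'I_n].
have sz : size s = n by rewrite size_map size_enum_ord.
have sumE (F : 'rV[R]_n -> R) : \sum_(v <- s) F v = \sum_j F ((N * w 0 j) *: e j).
  by rewrite big_map big_enum.
have := conv_mean_le f x s; rewrite sz sumE.
have -> : \sum_(v <- s) v = N *: w.
  rewrite big_map big_enum /= [in RHS](row_sum_delta w) scaler_sumr.
  by apply: eq_bigr => j _; rewrite scalerA.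
rewrite scalerA mulVf ?gt_eqF // scale1r -/N => h.
have wj j : `|w 0 j| <= `|w|.
  by rewrite [leRHS]/Num.norm /= mx_normrE; apply/bigmax_geP; right => /=; exists (0, j).
suff : N * (f (x + w) - f x) <= N * ((\sum_j c j) * `|w|) by rewrite ler_pM2l.
apply: le_trans h _; rewrite mulr_suml mulr_sumr; apply: ler_sum => j _.
have Nw : `|N * w 0 j| <= N * `|w| by rewrite normrM gtr0_norm // ler_pM2l.
apply: le_trans (conv_ray_le _ _ _ (le_trans Nw w1)) _.
by rewrite [c j * _]mulrC mulrA; exact: ler_wpM2r (c0 j) _ _ Nw.
Qed.

Lemma conv_continuous f : continuous (f : 'rV[R]_n -> R).
Proof.
move=> x; have [C C0 fC] := conv_upper_lipschitz f x.
have fCw w : n%:R * `|w| <= 1 -> `|f x - f (x + w)| <= C * `|w|.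
  move=> w1; have u := fC w w1; have := fC (- w); rewrite normrN => /(_ w1) l.
  have h01 : 0 <= (2^-1 : R) <= 1 by apply/andP; split; lra.
  have := conv_fun_le f (x + w) (x - w) h01.
  have -> : 2^-1 *: (x + w) + (1 - 2^-1) *: (x - w) = x.
    have -> : 1 - 2^-1 = 2^-1 :> R by lra.
    by rewrite -scalerDr addrACA subrr addr0 -mulr2n -[x *+ 2]scaler_nat scalerA mulVf ?scale1r.
  by move=> m; rewrite ler_norml; apply/andP; split; lra.
apply/(@cvgrPdist_lt R R^o _ _ (nbhs_filter (x : 'rV[R]_n))) => e e0.
pose d := Num.min ((n%:R + 1)^-1) (e / (C + 1)).
have C1 : 0 < C + 1 by lra.
have n1 : 0 < n%:R + 1 :> R by rewrite ltr_wpDl.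
have d0 : 0 < d by rewrite lt_min invr_gt0 n1 divr_gt0.
apply/(@nbhs_normP R 'rV[R]_n x); exists d => //= y; rewrite /ball_ /= distrC => yd.
have -> : y = x + (y - x) by rewrite addrC subrK.
set w := y - x in yd *.
move: yd; rewrite lt_min => /andP[w1 w2].
apply: le_lt_trans (fCw _ _) _.
  apply: (@le_trans _ _ ((n%:R + 1) * `|w|)).
    by apply: ler_wpM2r => //; lra.
  by rewrite -ler_pdivlMl // mulr1 ltW.
apply: (@le_lt_trans _ _ ((C + 1) * `|w|)); first by apply: ler_wpM2r => //; lra.
by rewrite -ltr_pdivlMl // mulrC.
Qed.

Lemma conv_uniform_cvg (F : nat -> Conv R n) f :
  (forall k x, `|f x - F k x| <= k.+1%:R^-1) -> F @ \oo --> f.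
Proof.
move=> Fle.
have h : (fun k => F k : {family compact, 'rV[R]_n -> R}) @ \oo -->
   (f : {family compact, 'rV[R]_n -> R}).
  apply/fam_cvgP => A _ P /uniform_nbhs[E [entE EP]].
  have [e e0 eE] := entE.
  suff : \forall k \near \oo, P (F k : 'rV[R]_n -> R) by [].
  apply: filterS (near_infty_natSinv_lt (PosNum e0)) => k ke.
  by apply: EP => y _; apply: eE; exact: le_lt_trans (Fle k y) ke.
move=> P [_ [[B oB <-] Bf] BP].
have hB : \forall k \near \oo, B (F k : 'rV[R]_n -> R).
  exact: h B (open_nbhs_nbhs (conj oB Bf)).
suff : \forall k \near \oo, P (F k) by [].
by apply: filterS hB => k; exact: BP.
Qed.

End ConvexContinuity.

Section MeasureLemmas.
Variables (R : realType) (n : nat).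
Implicit Types (mu nu : Meas R n) (phi : Cc R n).

Lemma meas_addE mu nu phi : (mu + nu) phi = mu phi + nu phi.
Proof. by []. Qed.

Lemma measD mu phi psi : mu (phi + psi) = mu phi + mu psi.
Proof.
case: mu => mu /= /asboolP[l _].
by have := l 1 phi psi; rewrite !scale1r.
Qed.

Lemma meas_eval_continuous phi : continuous (fun mu : Meas R n => mu phi).
Proof.
move=> mu P /(@proj_continuous (Cc R n) (fun=> R[i]^o) phi (meas_fun mu)) nP.
pose W : {ptws Cc R n -> R[i]^o} -> Prop := fun g => P (g phi).
have nW : nbhs (meas_fun mu : {ptws Cc R n -> R[i]^o}) W by exact: nP.
exact: (@initial_continuous (Meas R n) {ptws Cc R n -> R[i]^o}
  (@meas_fun R n) mu W nW).
Qed.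

Lemma real_complex_continuous (T : topologicalType) (g : T -> R) :
  continuous g -> continuous (fun x => (g x)%:C : R[i]^o).
Proof.
move=> cg x; apply/(@cvgrPdist_lt _ R[i]^o _ _ (nbhs_filter x)) => e e0.
have eE : e = (complex.Re e)%:C by rewrite RRe_real // gtr0_real.
have e0' : 0 < complex.Re e by rewrite eE ltcR in e0.
have := @cvgrPdist_lt _ R^o _ _ (nbhs_filter x) g (g x).
move=> [/(_ (cg x) _ e0') + _].
apply: filterS => t h; rewrite eE -rmorphB /=.
by rewrite normc_def /= expr0n /= addr0 sqrtr_sqr ltcR.
Qed.

(* Vanishes for [r <= - 1 / 2] and equals 1 for [1 / 2 <= r]. *)
Definition clamp (r : R) : R := Num.max 0 (Num.min 1 (r + 2^-1)).

Lemma clamp_continuous (T : topologicalType) (u : T -> R) :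
  continuous u -> continuous (fun x => clamp (u x)).
Proof.
move=> cu x.
apply: (@continuous_max R T (cst 0) (fun x => Num.min 1 (u x + 2^-1))).
  exact: cst_continuous.
apply: (@continuous_min R T (cst 1) (fun x => u x + 2^-1)).
  exact: cst_continuous.
by apply: (@cvgD _ R^o); [exact: cu|exact: cvg_cst].
Qed.

Definition cutoff (c : 'rV[R]_n -> R) phi : 'rV[R]_n -> R[i]^o :=
  fun x => (c x)%:C * phi x.

Lemma tsupp_cutoff c phi : tsupp (cutoff c phi) `<=` tsupp phi.
Proof.
apply: closure_subset => x /=; apply: contra_neq => p0.
by rewrite /cutoff p0 mulr0.
Qed.

Lemma tsupp_cutoff_closed c phi (K : set 'rV[R]_n) : closed K ->
  (forall x, ~ K x -> c x = 0) -> tsupp (cutoff c phi) `<=` K.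
Proof.
move=> /closure_id Kc Kv; rewrite [X in _ `<=` X]Kc.
apply: closure_subset => x /=; apply: contra_neqP => /Kv c0.
by rewrite /cutoff c0 mul0r.
Qed.

Lemma cutoff_test c phi : continuous c -> cutoff c phi \in @is_test R n.
Proof.
move=> cc; have sub := @tsupp_cutoff c phi.
have /asboolP[cphi kphi] : test_fun phi \in @is_test R n by case: phi {sub}.
apply/asboolP; split.
  move=> x; apply: (@cvgM R[i] _ (nbhs x) _ (fun x => (c x)%:C) phi).
    exact: real_complex_continuous.
  exact: cphi.
exact: subclosed_compact (@closed_closure _ _) kphi sub.
Qed.

Lemma eq_meas_cover (u : 'rV[R]_n -> R) mu nu : continuous u ->
  eq_meas_on [set x | u x < 1] mu nu -> eq_meas_on [set x | -1 < u x] mu nu ->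
  mu = nu.
Proof.
move=> cu lt1 gtN1.
suff E : forall phi, mu phi = nu phi.
  by apply/val_inj/funext => phi; exact: E.
move=> phi; pose c x := clamp (u x).
have cc : continuous c := clamp_continuous cu.
have cd : continuous (fun x => 1 - c x).
  move=> x; apply: (@cvgB _ R^o _ (nbhs x) _ (cst 1) c); first exact: cvg_cst.
  exact: cc.
pose phi1 := MkCc (cutoff_test phi cc); pose phi2 := MkCc (cutoff_test phi cd).
have -> : phi = phi1 + phi2.
  apply/val_inj/funext => x; rewrite /= /cutoff.
  have -> : (val phi1 + val phi2) x = (c x)%:C * phi x + (1 - c x)%:C * phi x by [].
  by rewrite -mulrDl -rmorphD addrC subrK mul1r.
rewrite !measD; congr (_ + _).
- apply: gtN1; apply: (@subset_trans _ [set x | - 2^-1 <= u x]).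
    apply: tsupp_cutoff_closed => [|x /= /negP]; last first.
      rewrite -ltNge /c /clamp => ux; apply/max_idPl.
      by rewrite ge_min; apply/orP; right; lra.
    apply: (@closed_comp _ _ u [set r | - 2^-1 <= r]); last exact: closed_ge.
    by move=> x _; exact: cu.
  move=> x /=; lra.
- apply: lt1; apply: (@subset_trans _ [set x | u x <= 2^-1]).
    apply: tsupp_cutoff_closed => [|x /= /negP]; last first.
      rewrite -ltNge /c /clamp => ux.
      rewrite min_l; last lra.
      by rewrite max_r ?subrr.
    apply: (@closed_comp _ _ u [set r | r <= 2^-1]); last exact: closed_le.
    by move=> x _; exact: cu.
  move=> x /=; lra.
Qed.

End MeasureLemmas.

Section LocalFunctional.
Variables (R : realType) (n : nat) (Psi : Conv R n -> Meas R n).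

Lemma eq_meas_onD (U : set 'rV[R]_n) (a b c d : Meas R n) :
  eq_meas_on U a c -> eq_meas_on U b d -> eq_meas_on U (a + b) (c + d).
Proof. by move=> ac bd phi pU; rewrite !meas_addE ac ?bd. Qed.

Definition conv_shrink (m f : Conv R n) (e : R) := conv_max m (conv_sub f e).

Lemma local_shrink (f h m : Conv R n) (e : R) : local_functional Psi ->
  (forall x, m x = Num.min (f x) (h x)) -> 0 < e ->
  Psi (conv_shrink m f e) + Psi (conv_shrink m h e) =
  Psi (conv_shrink m (conv_max f h) e) + Psi m.
Proof.
move=> loc mE e0; pose u x := e^-1 * (f x - h x).
have cu : continuous u.
  move=> x; apply: (@cvgM R _ (nbhs x) _ (cst e^-1) (fun x => f x - h x)).
    exact: cvg_cst.
  by apply: (@cvgB _ R^o _ (nbhs x) _ f h); exact: conv_continuous.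
have ufh x : u x * e = f x - h x by rewrite /u mulrAC mulVf ?mul1r // gt_eqF.
have shrink_le (g : Conv R n) x : g x - e <= m x -> conv_shrink m g e x = m x.
  by move=> ?; exact: max_l.
have oltu : open [set x | u x < 1].
  by apply: (open_comp _ (@open_lt R 1)) => x _; exact: cu.
have ogtu : open [set x | -1 < u x].
  by apply: (open_comp _ (@open_gt R (-1))) => x _; exact: cu.
have ltu x : u x < 1 -> f x - h x < e by move=> ?; rewrite -ufh; nra.
have gtu x : -1 < u x -> h x - f x < e.
  by move=> ?; rewrite -opprB -ufh; nra.
apply: (eq_meas_cover cu).
- rewrite [X in eq_meas_on _ _ X]addrC.
  apply: eq_meas_onD; apply: loc => // x /ltu fh.
    by apply: shrink_le; rewrite mE le_min; apply/andP; split; lra.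
  by rewrite /= mE /Order.max /Order.min; do !case: ifPn; rewrite -?leNgt; lra.
- apply: eq_meas_onD; apply: loc => // x /gtu hf; last first.
    by apply: shrink_le; rewrite mE le_min; apply/andP; split; lra.
  by rewrite /= mE /Order.max /Order.min; do !case: ifPn; rewrite -?leNgt; lra.
Qed.

Lemma conv_shrink_cvg (m f : Conv R n) : (forall x, m x <= f x) ->
  conv_shrink m f k.+1%:R^-1 @[k --> \oo] --> f.
Proof.
move=> mf; apply: conv_uniform_cvg => k x /=; set e : R := k.+1%:R^-1.
have e0 : 0 <= e by rewrite invr_ge0.
have mfx := mf x.
rewrite ger0_norm ?subr_ge0 ?ge_max; last first.
  by rewrite mfx /=; lra.
have : f x - e <= Num.max (m x) (f x - e) by rewrite le_max lexx orbT.
lra.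
Qed.

End LocalFunctional.

Theorem theorem1 (R : realType) (n : nat) (Psi : Conv R n -> Meas R n)
    (Psi_cont : continuous Psi) (Psi_local : local_functional Psi) :
  valuation Psi.
Proof.
move=> f h m mE.
have mf x : m x <= f x by rewrite mE ge_min lexx.
have mh x : m x <= h x by rewrite mE ge_min lexx orbT.
have mM x : m x <= conv_max f h x by rewrite /= le_max mf.
apply/val_inj/funext => phi.
have ev (g : Conv R n) : (forall x, m x <= g x) ->
    Psi (conv_shrink m g k.+1%:R^-1) phi @[k --> \oo] --> (Psi g phi : R[i]^o).
  move=> /conv_shrink_cvg gcvg.
  apply: (@continuous_cvg _ _ _ \oo _ _ (fun nu : Meas R n => nu phi)).
    exact: meas_eval_continuous.
  by apply: (@continuous_cvg _ _ _ \oo _ _ Psi) => //; exact: Psi_cont.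
pose ev_shrink g k : R[i]^o := Psi (conv_shrink m g k.+1%:R^-1) phi.
have lhs : ev_shrink f \+ ev_shrink h @ \oo --> (Psi f phi + Psi h phi : R[i]^o).
  exact: cvgD (ev f mf) (ev h mh).
have rhs : ev_shrink (conv_max f h) \+ cst (Psi m phi) @ \oo -->
    (Psi (conv_max f h) phi + Psi m phi : R[i]^o).
  exact: cvgD (ev _ mM) (cvg_cst _).
have E : ev_shrink f \+ ev_shrink h = ev_shrink (conv_max f h) \+ cst (Psi m phi).
  apply/funext => k; have k0 : 0 < k.+1%:R^-1 :> R by rewrite invr_gt0.
  exact: (congr1 (fun nu : Meas R n => nu phi) (local_shrink Psi_local mE k0)).
rewrite E in lhs.
exact: (@cvg_unique _ (@norm_hausdorff _ R[i]^o) _ _ _ _ lhs rhs).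
Qed.
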